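(* A ring $R$ has stable rank $1$ if and only if every matrix in $\mathrm{GL}_2(R)$ can be reduced to a diagonal matrix by at most three elementary operations.
   Context: Rings are associative and unital. A ring $R$ has stable rank $1$ if for all $a,b\in R$ with $aR+bR=R$ there is some $x\in R$ such that $a+bx$ is a unit of $R$. A $2\times 2$ elementary matrix is one of the form $\begin{bmatrix}1 & x\\ 0 & 1\end{bmatrix}$ or $\begin{bmatrix}1 & 0\\ x & 1\end{bmatrix}$ with $x\in R$; an elementary row (respectively column) operation is left (respectively right) multiplication by an elementary matrix, and an elementary operation is an elementary row or column operation (row and column operations may be mixed). *)

(* Defs.v *)
From HB Require Import structures.
From mathcomp Require Import all_boot all_order all_algebra.

Set Implicit Arguments.
Unset Strict Implicit.
Unset Printing Implicit Defensive.

Import GRing.Theory.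
Local Open Scope ring_scope.

(* Rings are [pzRingType]s, so the zero ring is allowed. They carry no         *)
(* [unitRingType] structure (and [unitmx] needs commutativity), so being a     *)
(* unit is stated by the existence of a two-sided inverse.                     *)
Definition is_unit (R : pzRingType) (u : R) : Prop :=
  exists v : R, u * v = 1 /\ v * u = 1.

Definition right_unimodular (R : pzRingType) (a b : R) : Prop :=
  forall r : R, exists x y : R, a * x + b * y = r.

Definition stable_rank1 (R : pzRingType) : Prop :=
  forall a b : R, right_unimodular a b -> exists x : R, is_unit (a + b * x).

Definition in_GL2 (R : pzRingType) (A : 'M[R]_2) : Prop :=
  exists B : 'M[R]_2, A *m B = 1%:M /\ B *m A = 1%:M.

(* mx2 a b c d has rows (a, b) and (c, d). *)
Definition mx2 (R : pzRingType) (a b c d : R) : 'M[R]_2 :=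
  \matrix_(i < 2, j < 2)
    if i == 0%N :> nat then (if j == 0%N :> nat then a else b)
    else (if j == 0%N :> nat then c else d).

Definition elementary2 (R : pzRingType) (E : 'M[R]_2) : Prop :=
  exists x : R, E = mx2 1 x 0 1 \/ E = mx2 1 0 x 1.

Definition elementary_op (R : pzRingType) (A B : 'M[R]_2) : Prop :=
  exists2 E : 'M[R]_2, elementary2 E & B = E *m A \/ B = A *m E.

Fixpoint reduces_in (R : pzRingType) (n : nat) (A D : 'M[R]_2) : Prop :=
  if n is m.+1 then exists2 B : 'M[R]_2, elementary_op A B & reduces_in m B D
  else A = D.

Definition diag_reducible_within (R : pzRingType) (n : nat) (A : 'M[R]_2) : Prop :=
  exists k : nat, (k <= n)%N /\
    exists2 D : 'M[R]_2, reduces_in k A D & is_diag_mx D.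

(* Main.v *)
Require Import Defs.
From mathcomp Require Import all_boot all_order all_algebra.

(** Stable rank 1 says that the top row [(a, b)] of an invertible matrix can be
    turned, by one lower column operation, into a row starting with a unit; two
    more operations then clear the remaining off-diagonal entries.  This is the
    forward direction ([stable_rank1_diag_reducible]).

    For the converse, an invertible diagonal matrix normalizes the elementary
    matrices, so mixed row and column operations can all be moved to one side:
    a matrix reducible in three operations is [E1 E2 E3 D] with [E1], [E2], [E3]
    elementary and [D] invertible diagonal ([reduces_in_elem_prod]).  According
    to whether [E1] is lower or upper, either the top row [(a, b)] makes some
    [a + b t] a unit, or the bottom row [(c, d)] makes some [d + c t] a unit
    ([elem_prod3_row]).  The point is then to find a matrix for which both
    alternatives say the same thing.  When [a x + b y = 1], the matrix
    [[
       a        a x - 1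
       1 - x a  x + (1 - x a) x
    ]]
    is invertible.  Its top row asks for a unit in [a + (1 - a x) R], its bottom
    row for a unit in [x + (1 - x a) R], and these two conditions are equivalent
    by the identity [a u + (1 - a x) (1 - a s) = 1], valid for
    [u = x + (1 - x a) s] ([unit_translate_swap]).  Since [1 - a x = b y], the
    first one is what stable rank 1 asks of [(a, b)]. *)

Set Implicit Arguments.
Unset Strict Implicit.
Unset Printing Implicit Defensive.

Import GRing.Theory.
Local Open Scope ring_scope.

(** * Two by two matrices given by their entries *)

Section TwoByTwo.

Variable R : pzRingType.
Implicit Types (a b c d x y u v : R) (A B D E : 'M[R]_2).

Lemma mx2_eta A : A = mx2 (A 0 0) (A 0 1) (A 1 0) (A 1 1).
Proof.
apply/matrixP=> i j; rewrite mxE.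
by case: i => [[|[|//]] Hi]; case: j => [[|[|//]] Hj];
   congr (A _ _); apply: val_inj.
Qed.

Lemma mul_mx2 a b c d a' b' c' d' :
  mx2 a b c d *m mx2 a' b' c' d' =
  mx2 (a * a' + b * c') (a * b' + b * d') (c * a' + d * c') (c * b' + d * d').
Proof.
by apply/matrixP=> -[[|[|//]] Hi] [[|[|//]] Hj];
   rewrite !mxE !big_ord_recl big_ord0 !mxE /= addr0.
Qed.

Lemma mx2_1 : 1%:M = mx2 1 0 0 1 :> 'M[R]_2.
Proof. by rewrite [LHS]mx2_eta !mxE. Qed.

Lemma mx2_inj a b c d a' b' c' d' :
  mx2 a b c d = mx2 a' b' c' d' -> [/\ a = a', b = b', c = c' & d = d'].
Proof.
move=> eqM; have e i j := congr1 (fun M : 'M[R]_2 => M i j) eqM.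
by have := (e 0 0, e 0 1, e 1 0, e 1 1); rewrite !mxE /= => -[[[]]].
Qed.

Lemma is_diag_mx2 a d : is_diag_mx (mx2 a 0 0 d).
Proof.
by apply/is_diag_mxP=> -[[|[|//]] Hi] [[|[|//]] Hj]; rewrite mxE.
Qed.

Lemma diag_mx2_eta D : is_diag_mx D -> D = mx2 (D 0 0) 0 0 (D 1 1).
Proof.
by move=> /is_diag_mxP dD; rewrite {1}[D]mx2_eta [D 0 1]dD // [D 1 0]dD.
Qed.

Lemma mul_lower x y : mx2 1 0 x 1 *m mx2 1 0 y 1 = mx2 1 0 (x + y) 1.
Proof. by rewrite mul_mx2 !(mul0r, mul1r, mulr0, mulr1, add0r, addr0). Qed.

Lemma mul_upper x y : mx2 1 x 0 1 *m mx2 1 y 0 1 = mx2 1 (x + y) 0 1.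
Proof.
by rewrite mul_mx2 !(mul0r, mul1r, mulr0, mulr1, add0r, addr0) addrC.
Qed.

Lemma in_GL2_mul A B : in_GL2 A -> in_GL2 B -> in_GL2 (A *m B).
Proof.
move=> [A' [AA' A'A]] [B' [BB' B'B]]; exists (B' *m A'); split.
  by rewrite mulmxA -(mulmxA A) BB' mulmx1.
by rewrite mulmxA -(mulmxA B') A'A mulmx1.
Qed.

Lemma elementary2_inv E :
  elementary2 E ->
  exists2 E', elementary2 E' & E *m E' = 1%:M /\ E' *m E = 1%:M.
Proof.
case=> x [->|->].
  exists (mx2 1 (- x) 0 1); first by exists (- x); left.
  by rewrite !mul_upper subrr addNr mx2_1.
exists (mx2 1 0 (- x) 1); first by exists (- x); right.
by rewrite !mul_lower subrr addNr mx2_1.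
Qed.

Lemma elementary2_GL2 E : elementary2 E -> in_GL2 E.
Proof. by move=> /elementary2_inv[E' _ EE']; exists E'. Qed.

Lemma elementary2_1 : elementary2 (1%:M : 'M[R]_2).
Proof. by exists 0; left; rewrite mx2_1. Qed.

Lemma is_unitV u : is_unit u -> exists2 v, is_unit v & u * v = 1 /\ v * u = 1.
Proof. by move=> [v [uv vu]]; exists v => //; exists u. Qed.

(** * Stable rank 1 gives a reduction in three steps *)

Lemma in_GL2_right_unimodular A :
  in_GL2 A -> right_unimodular (A 0 0) (A 0 1).
Proof.
move=> [B [AB _]] r; exists (B 0 0 * r), (B 1 0 * r).
move: AB; rewrite [A]mx2_eta [B]mx2_eta mul_mx2 mx2_1 => /mx2_inj[e _ _ _].
by move: e; rewrite !mxE /= !mulrA -mulrDl => ->; rewrite mul1r.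
Qed.

Lemma stable_rank1_diag_reducible A :
  stable_rank1 R -> in_GL2 A -> diag_reducible_within 3 A.
Proof.
move=> sr1 /in_GL2_right_unimodular /sr1 [x [v [uv vu]]].
rewrite [A]mx2_eta; move: uv vu.
move: (A 0 0) (A 0 1) (A 1 0) (A 1 1) => a b c d.
set u := a + b * x => uv vu; set c1 := c + d * x.
exists 3%N; split=> //; exists (mx2 u 0 0 (d - c1 * v * b)); last exact: is_diag_mx2.
exists (mx2 u b c1 d).
  exists (mx2 1 0 x 1); first by exists x; right.
  by right; rewrite mul_mx2 !mulr1 !mulr0 !add0r.
exists (mx2 u b 0 (d - c1 * v * b)).
  exists (mx2 1 0 (- (c1 * v)) 1); first by exists (- (c1 * v)); right.
  left; rewrite mul_mx2 !mul1r !mul0r !addr0 !mulNr -(mulrA c1 v u) vu mulr1.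
  by rewrite addNr [- _ + d]addrC.
exists (mx2 u 0 0 (d - c1 * v * b)) => //.
exists (mx2 1 (- (v * b)) 0 1); first by exists (- (v * b)); left.
right; rewrite mul_mx2 !mulr1 !mulr0 !mul0r !addr0 mulrN mulrA uv mul1r.
by rewrite addNr add0r.
Qed.

(** * Moving all operations to the left *)

Fixpoint elem_prod (n : nat) (A : 'M[R]_2) : Prop :=
  if n is m.+1 then
    exists E B, [/\ elementary2 E, elem_prod m B & A = E *m B]
  else exists u v, [/\ is_unit u, is_unit v & A = mx2 u 0 0 v].

(** Conjugating an elementary matrix by [diag(u, v)] multiplies its
    off-diagonal entry by units, so that the right factor can be carried
    through [D] to the end of the word. *)
Lemma elem_prod_mulr n A E :
  elem_prod n A -> elementary2 E -> elem_prod n.+1 (A *m E).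
Proof.
move=> + elE; elim: n A => [|n IHn] A /=; last first.
  move=> [F [B [elF /IHn BE ->]]]; exists F, (B *m E).
  by rewrite mulmxA.
move=> [u [v [uu uv ->]]].
have [u' _ [uu' u'u]] := is_unitV uu; have [v' _ [vv' v'v]] := is_unitV uv.
case: elE => x [->|->].
  exists (mx2 1 (u * x * v') 0 1), (mx2 u 0 0 v); split.
  - by exists (u * x * v'); left.
  - by exists u, v.
  by rewrite !mul_mx2 -(mulrA (u * x) v' v) v'v
    !(mul0r, mul1r, mulr0, mulr1, add0r, addr0).
exists (mx2 1 0 (v * x * u') 1), (mx2 u 0 0 v); split.
- by exists (v * x * u'); right.
- by exists u, v.
by rewrite !mul_mx2 -(mulrA (v * x) u' u) u'u
  !(mul0r, mul1r, mulr0, mulr1, add0r, addr0).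
Qed.

Lemma diag_GL2_elem_prod D : in_GL2 D -> is_diag_mx D -> elem_prod 0 D.
Proof.
move=> [B [+ +]] /diag_mx2_eta eD; rewrite eD [B]mx2_eta !mul_mx2 mx2_1.
rewrite !mul0r !mulr0 !addr0 !add0r.
move=> /mx2_inj[e1 _ _ e2] /mx2_inj[f1 _ _ f2].
by exists (D 0 0), (D 1 1); split; [exists (B 0 0) | exists (B 1 1) | ].
Qed.

Lemma reduces_in_elem_prod n A D :
  in_GL2 A -> reduces_in n A D -> is_diag_mx D -> elem_prod n A.
Proof.
move=> + + diagD; elim: n A => [|n IHn] A glA /=.
  by move=> eAD; rewrite eAD in glA *; apply: diag_GL2_elem_prod.
move=> [B [E elE AB] redB].
have [E' elE' [EE' E'E]] := elementary2_inv elE.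
have glB : in_GL2 B.
  by case: AB => ->; apply: in_GL2_mul => //; apply: elementary2_GL2.
have pB := IHn _ glB redB; case: AB => eB.
  by exists E', B; split; rewrite // eB mulmxA E'E mul1mx.
suff -> : A = B *m E' by apply: elem_prod_mulr.
by rewrite eB -mulmxA EE' mulmx1.
Qed.

(** Words can be padded, the identity being elementary. *)
Lemma elem_prod_leq m n A : (m <= n)%N -> elem_prod m A -> elem_prod n A.
Proof.
move=> /subnK <-; elim: (n - m)%N => // k IHk /IHk pA.
by exists 1%:M, A; rewrite mul1mx; split=> //; apply: elementary2_1.
Qed.

(** * The rows of a product of three elementary matrices *)

Definition top_row_unit A := exists t, is_unit (A 0 0 + A 0 1 * t).
Definition bottom_row_unit A := exists t, is_unit (A 1 1 + A 1 0 * t).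

(** Conjugation by the permutation matrix of the two indices; it exchanges
    lower and upper elementary matrices and the two row conditions. *)
Definition swap2 A : 'M[R]_2 := mx2 (A 1 1) (A 1 0) (A 0 1) (A 0 0).

Lemma swap2_mx2 a b c d : swap2 (mx2 a b c d) = mx2 d c b a.
Proof. by rewrite /swap2 !mxE. Qed.

Lemma swap2M A B : swap2 (A *m B) = swap2 A *m swap2 B.
Proof.
rewrite [A]mx2_eta [B]mx2_eta mul_mx2 !swap2_mx2 mul_mx2.
by congr mx2; apply: addrC.
Qed.

Lemma elementary2_swap E : elementary2 E -> elementary2 (swap2 E).
Proof.
by move=> [x [->|->]]; exists x; [right | left]; rewrite swap2_mx2.
Qed.

Lemma elem_prod_swap n A : elem_prod n A -> elem_prod n (swap2 A).
Proof.
elim: n A => [|n IHn] A /=.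
  by move=> [u [v [uu uv ->]]]; exists v, u; rewrite swap2_mx2.
move=> [E [B [elE /IHn pB ->]]]; exists (swap2 E), (swap2 B).
by rewrite swap2M; split=> //; apply: elementary2_swap.
Qed.

Lemma top_row_swap A : top_row_unit (swap2 A) -> bottom_row_unit A.
Proof. by rewrite /top_row_unit !mxE. Qed.

Lemma top_row_lower_mul x A : top_row_unit A -> top_row_unit (mx2 1 0 x 1 *m A).
Proof.
move=> [t ut]; exists t; move: ut; rewrite {3 4}[A]mx2_eta mul_mx2.
by rewrite [mx2 _ _ _ _ 0 0]mxE [mx2 _ _ _ _ 0 1]mxE /= !mul1r !mul0r !addr0.
Qed.

(** The top left entry of [E D] is already a unit, and so is that of [L E D]
    with [L] lower and of [U U' D] with [U], [U'] upper.  In the remaining case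
    [U L D], a column operation undoes [L]. *)
Lemma elem_prod2_top_row A : elem_prod 2 A -> top_row_unit A.
Proof.
have top1 B : elem_prod 1 B -> top_row_unit B.
  move=> [E [D [elE [u [v [uu _ ->]]] ->]]]; exists 0; rewrite mulr0 addr0.
  by case: elE => x [->|->]; rewrite mul_mx2 mxE /=
    !(mul0r, mul1r, mulr0, addr0).
move=> [E [B [[x [->|->]] pB ->]]]; last exact: top_row_lower_mul (top1 _ pB).
case: pB => F [D [[y [->|->]] [u [v [uu uv ->]]] ->]].
  rewrite mulmxA mul_upper; apply: top1.
  exists (mx2 1 (x + y) 0 1), (mx2 u 0 0 v); split=> //; last by exists u, v.
  by exists (x + y); left.
(* The top row is ((1 + x y) u, x v). *)
have [v' _ [vv' _]] := is_unitV uv; exists (- (v' * (y * u))).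
rewrite !mul_mx2 !mxE /= !(mul0r, mul1r, mulr0, add0r, addr0).
by rewrite mulrN -mulrA (mulrA v) vv' mul1r addrK.
Qed.

(** A lower first factor leaves the top row to the other two; an upper one
    leaves the bottom row to them, which is the same case up to [swap2]. *)
Lemma elem_prod3_row A :
  elem_prod 3 A -> top_row_unit A \/ bottom_row_unit A.
Proof.
move=> [E [B [[x [->|->]] pB ->]]]; [right | left]; last first.
  exact/top_row_lower_mul/elem_prod2_top_row.
apply: top_row_swap; rewrite swap2M swap2_mx2.
exact/top_row_lower_mul/elem_prod2_top_row/elem_prod_swap.
Qed.

(** * A matrix whose two row conditions coincide *)

(** The right factor [mx2 a (a * x - 1) 1 x] of this matrix is the obvious
    completion of the row [(a, a x - 1)]; subtracting [x] times the first row
    from the second is what makes the bottom row look like the top one with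
    [a] and [x] exchanged. *)
Lemma swap_symmetric_GL2 a x :
  in_GL2 (mx2 a (a * x - 1) (1 - x * a) (x + (1 - x * a) * x)).
Proof.
have glU y : in_GL2 (mx2 1 y 0 1) by apply: elementary2_GL2; exists y; left.
have glL y : in_GL2 (mx2 1 0 y 1) by apply: elementary2_GL2; exists y; right.
have glW : in_GL2 (mx2 0 (- 1) 1 0 : 'M[R]_2).
  exists (mx2 0 1 (- 1) 0); rewrite !mul_mx2 mx2_1.
  by rewrite !(mul0r, mulr0, mulrNN, mulr1, add0r, addr0).
suff -> : mx2 a (a * x - 1) (1 - x * a) (x + (1 - x * a) * x) =
    mx2 1 0 (- x) 1 *m (mx2 1 a 0 1 *m (mx2 0 (- 1) 1 0 *m mx2 1 x 0 1)).
  by apply: in_GL2_mul => //; apply: in_GL2_mul => //; apply: in_GL2_mul.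
rewrite !mul_mx2 !(mul0r, mul1r, mulr0, mulr1, mulNr, oppr0, add0r, addr0).
congr mx2; first exact: addrC.
  exact: addrC.
by rewrite [RHS]addrC; congr (x + _);
   rewrite mulrBl mul1r -mulrN opprD opprK mulrBr mulr1 mulrA.
Qed.

(** For [u = x + (1 - x a) s], expanding gives
    [a u + (1 - a x) (1 - a s) = 1]; multiplying by the inverse of [u] puts
    that inverse in [a + (1 - a x) R]. *)
Lemma unit_translate_swap a x s :
  is_unit (x + (1 - x * a) * s) -> exists t, is_unit (a + (1 - a * x) * t).
Proof.
set u := x + _ => uu; have [v vu [uv _]] := is_unitV uu.
exists ((1 - a * s) * v); suff -> : a + (1 - a * x) * ((1 - a * s) * v) = v by [].
have id1 : a * u + (1 - a * x) * (1 - a * s) = 1.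
  (* Since a (1 - x a) = (1 - a x) a. *)
  have -> : a * u = a * x + (1 - a * x) * (a * s).
    by rewrite /u mulrDr !mulrA [in RHS]mulrBl mulrBr mul1r mulr1 mulrA.
  by rewrite -addrA -mulrDr addrCA subrr addr0 mulr1 addrCA subrr addr0.
by rewrite -[RHS]mul1r -[in RHS]id1 [in RHS]mulrDl -(mulrA a u v) uv mulr1 mulrA.
Qed.

Lemma diag_reducible_stable_rank1 :
  (forall A, in_GL2 A -> diag_reducible_within 3 A) -> stable_rank1 R.
Proof.
move=> red a b /(_ 1) [x [y axby]].
have by1 : b * y = 1 - a * x by rewrite -axby addrAC subrr add0r.
suff [t ut] : exists t, is_unit (a + (1 - a * x) * t).
  by exists (y * t); rewrite mulrA by1.
have glA := swap_symmetric_GL2 a x.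
have [k [le_k3 [D redA diagD]]] := red _ glA.
have /elem_prod3_row := elem_prod_leq le_k3 (reduces_in_elem_prod glA redA diagD).
case=> -[t]; rewrite !mxE /=.
  by exists (- t); rewrite mulrN -mulNr opprB.
by rewrite -addrA -mulrDr => /unit_translate_swap.
Qed.

End TwoByTwo.

Theorem theorem6p2 (R : pzRingType) :
  stable_rank1 R <->
  (forall A : 'M[R]_2, in_GL2 A -> diag_reducible_within 3 A).
Proof.
split=> [sr1 A|]; first exact: stable_rank1_diag_reducible.
exact: diag_reducible_stable_rank1.
Qed.
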